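(* The class $K^{LCC}$ is faithful: whenever $(\Gamma_1,X_1),(\Gamma_2,X_2)\in K^{LCC}$ and $\Phi\colon\Gamma_1\to\Gamma_2$ is an isomorphism of abstract groups, there exists a homeomorphism $\phi\colon X_1\to X_2$ such that $\Phi(\gamma)=\phi\circ\gamma\circ\phi^{-1}$ for every $\gamma\in\Gamma_1$.
   Context: A Boolean space is a Hausdorff space with a basis of compact open sets; a locally compact Cantor space is a non-empty second countable Boolean space without isolated points. $\operatorname{supp}(\phi)$ is the closure of $\{x:\phi(x)\neq x\}$; $\operatorname{Homeo}_c(X)$ is the set of homeomorphisms with compact open support. A space-group pair is $(\Gamma,X)$ with $X$ Boolean and $\Gamma\le\operatorname{Homeo}(X)$, $\Gamma\subseteq\operatorname{Homeo}_c(X)$. Such a pair is locally moving if every non-empty open $A\subseteq X$ admits $\gamma\in\Gamma\setminus\{1\}$ with $\operatorname{supp}(\gamma)\subseteq A$. An open set $B$ is flexible if for all open $C_1,C_2\subseteq B$: if some $\gamma\in\Gamma$ has $\gamma(C_1)\cap C_2\ne\emptyset$, then some $\tau\in\Gamma$ with $\operatorname{supp}(\tau)\subseteq B$ has $\tau(C_1)\cap C_2\ne\emptyset$. The pair is locally flexible if every non-empty open set contains a non-empty open flexible subset. A clopen $A\subseteq X$ is recognizable by $\Gamma$ if (1) for every $\gamma\in\Gamma$ with $\gamma(A)=A$, the homeomorphism equal to $\gamma$ on $A$ and the identity elsewhere lies in $\Gamma$; and (2) for every $\gamma\in\Gamma$ with $\gamma(A)\cap A=\emptyset$, the involution equal to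 $\gamma$ on $A$, to $\gamma^{-1}$ on $\gamma(A)$ and the identity elsewhere lies in $\Gamma$. The class $K^{LCC}$ consists of space-group pairs $(\Gamma,X)$ such that: (K1) $X$ is a locally compact Cantor space; (K2) $(\Gamma,X)$ is locally moving; (K3) $(\Gamma,X)$ is locally flexible; (K4) every clopen subset of $X$ is recognizable by $\Gamma$; (K5) the $\Gamma$-orbit of each point has at least $3$ points. *)

(* Defs.v *)
From HB Require Import structures.
From mathcomp Require Import all_boot all_order.
From mathcomp Require Import all_classical all_reals all_analysis.
Set Implicit Arguments. Unset Strict Implicit. Unset Printing Implicit Defensive.
Local Open Scope classical_set_scope.

Definition homeo {X Y : topologicalType} (f : X -> Y) : Prop :=
  exists g : Y -> X, [/\ cancel f g, cancel g f, continuous f & continuous g].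

Definition boolean_space (X : topologicalType) : Prop :=
  hausdorff_space X /\ basis [set U : set X | open U /\ compact U].

Definition isolated_point {X : topologicalType} (x : X) : Prop := open [set x].

Definition lcc_space (X : topologicalType) : Prop :=
  [/\ (exists x : X, True), @second_countable X, boolean_space X
    & forall x : X, ~ isolated_point x].

Definition supp {X : topologicalType} (f : X -> X) : set X :=
  closure [set x | f x <> x].

Definition homeo_c {X : topologicalType} (f : X -> X) : Prop :=
  [/\ homeo f, open (supp f) & compact (supp f)].

Definition space_group_pair (X : topologicalType) (G : set (X -> X)) : Prop :=
  [/\ boolean_space X,
      G (@id X),
      (forall f g, G f -> G g -> G (f \o g)),
      (forall f, G f -> exists g, [/\ G g, cancel f g & cancel g f])
    & (forall f, G f -> homeo_c f)].

Definition locally_moving {X : topologicalType} (G : set (X -> X)) : Prop :=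
  forall A : set X, open A -> A !=set0 ->
    exists g, [/\ G g, g <> @id X & supp g `<=` A].

Definition flexible {X : topologicalType} (G : set (X -> X)) (B : set X) : Prop :=
  open B /\
  forall C1 C2 : set X, open C1 -> open C2 -> C1 `<=` B -> C2 `<=` B ->
    (exists g, G g /\ (g @` C1) `&` C2 !=set0) ->
    exists t, [/\ G t, supp t `<=` B & (t @` C1) `&` C2 !=set0].

Definition locally_flexible {X : topologicalType} (G : set (X -> X)) : Prop :=
  forall A : set X, open A -> A !=set0 ->
    exists B, [/\ B `<=` A, B !=set0 & flexible G B].

Definition recognizable {X : topologicalType} (G : set (X -> X)) (A : set X) : Prop :=
  clopen A /\
  (forall g, G g -> g @` A = A -> G (fun x => if x \in A then g x else x)) /\
  (forall g g', G g -> cancel g g' -> cancel g' g -> (g @` A) `&` A = set0 ->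
     G (fun x => if x \in A then g x
                 else if x \in g @` A then g' x else x)).

Definition orbit_ge3 {X : topologicalType} (G : set (X -> X)) : Prop :=
  forall x : X, exists a b c : X,
    (exists g, G g /\ g x = a) /\ (exists g, G g /\ g x = b) /\
    (exists g, G g /\ g x = c) /\ [/\ a <> b, b <> c & a <> c].

Definition in_KLCC (X : topologicalType) (G : set (X -> X)) : Prop :=
  @space_group_pair X G /\
  [/\ lcc_space X,
      locally_moving G,
      locally_flexible G,
      (forall A : set X, clopen A -> recognizable G A)
    & orbit_ge3 G].

(* Phi : G1 -> G2 is an isomorphism of abstract groups (values of Phi
   outside G1 are irrelevant). *)
Definition group_iso {X1 X2 : topologicalType} (G1 : set (X1 -> X1))
  (G2 : set (X2 -> X2)) (Phi : (X1 -> X1) -> (X2 -> X2)) : Prop :=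
  [/\ (forall f, G1 f -> G2 (Phi f)),
      (forall f g, G1 f -> G1 g -> Phi f = Phi g -> f = g),
      (forall h, G2 h -> exists2 f, G1 f & Phi f = h)
    & (forall f g, G1 f -> G1 g -> Phi (f \o g) = Phi f \o Phi g)].

(* Main.v *)
(* For an involution p of the group, the set of the w with supp w contained in
   supp p is definable from the group operations alone (compare Fremlin, Measure
   Theory, section 384): the u that are involutions, commute with p and commute
   with their conjugates under the centralizer of p are supported in supp p and
   include the restrictions of p to the clopen p-invariant sets; the squares of
   the elements commuting with all such u therefore live off supp p, there are
   such squares near every point off supp p, and w commutes with all of them iff
   supp w is contained in supp p. Hence an isomorphism Phi preserves inclusion
   and disjointness of supports of involutions. Send x to the point y lying in
   exactly those supp (Phi p) for which x lies in supp p: it exists by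
   compactness, and it is unique and depends continuously on x because, orbits
   having at least three points, intersections of two supports of involutions
   form a basis of the topology. *)

Require Import Defs.
From HB Require Import structures.
From mathcomp Require Import all_boot all_order.
From mathcomp Require Import all_classical all_reals all_analysis.
Local Open Scope classical_set_scope.

(** * Moved points and separation of images *)

Definition moved {X : Type} (f : X -> X) : set X := [set x | f x <> x].

Lemma moved_sub_supp (X : topologicalType) (f : X -> X) : moved f `<=` supp f.
Proof. exact: subset_closure. Qed.

Lemma movedN (X : Type) (f : X -> X) (A : set X) (x : X) :
  moved f `<=` A -> ~ A x -> f x = x.
Proof. by move=> fA; apply: contra_notP; exact: fA. Qed.

(** A point moved by [f] and its image both lie in [A], by injectivity, and there [g] is the
    identity. *)
Lemma moved_disjoint_comm (X : Type) (f g : X -> X) (A : set X) :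
  injective f -> injective g -> moved f `<=` A -> moved g `<=` ~` A ->
  f \o g = g \o f.
Proof.
move=> fi gi fA gA; apply/funext => x /=.
have gfix y : A y -> g y = y by move=> Ay; apply: (movedN _ _ _ _ gA) => /(_ Ay).
have [fx|fx] := pselect (f x = x); last first.
  rewrite !gfix //; last exact: fA.
  by apply: fA => /fi.
rewrite fx; have [//|gx] := pselect (f (g x) = g x).
have := gfix _ (fA _ gx) => /gi ggx.
by rewrite ggx fx.
Qed.

(** With [h = id] this yields sets displaced by [f]; with two group elements, disjoint
    translates. *)
Lemma sep_nbhs (X Y : topologicalType) (f h : X -> Y) (x : X) :
  hausdorff_space Y -> continuous f -> continuous h -> f x <> h x ->
  exists U, [/\ open U, U x & forall a b, U a -> U b -> f a <> h b].
Proof.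
move=> hY cf ch /eqP fh; move: hY; rewrite open_hausdorff => /(_ _ _ fh).
move=> [[A B] /= [/set_mem Ax /set_mem Bx] [oA oB /eqP AB]].
exists (f @^-1` A `&` h @^-1` B); split=> //.
  by apply: openI; [move/continuousP: cf | move/continuousP: ch]; exact.
move=> a b [Aa _] [_ Bb] ab.
have : (A `&` B) (f a) by split=> //; rewrite ab.
by rewrite AB.
Qed.

Lemma boolean_clopen_nbhs (X : topologicalType) (U : set X) (x : X) :
  boolean_space X -> open U -> U x -> exists V, [/\ clopen V, V x & V `<=` U].
Proof.
move=> [hX [Bo Bn]] oU Ux.
have /Bn [V [[oV cV] Vx] VU] : nbhs x U by apply: open_nbhs_nbhs.
by exists V; split=> //; split=> //; exact: compact_closed.
Qed.

(** * Elements of small support in one group of the class *)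

Section KLCC.
Variables (X : topologicalType) (G : set (X -> X)).
Hypothesis KG : in_KLCC G.

Let booleanX : boolean_space X. Proof. by case: KG => -[]. Qed.
Let hausdorffX : hausdorff_space X. Proof. by case: booleanX. Qed.

Lemma KLCC_id : G id. Proof. by case: KG => -[]. Qed.

Lemma KLCC_comp f g : G f -> G g -> G (f \o g).
Proof. by case: KG => -[_ _ + _ _] _; exact. Qed.

Lemma KLCC_inv f : G f -> exists g, [/\ G g, cancel f g & cancel g f].
Proof. by case: KG => -[_ _ _ + _] _; exact. Qed.

Lemma KLCC_inj f : G f -> injective f.
Proof. by move=> /KLCC_inv[g [_ /can_inj]]. Qed.

Lemma KLCC_supp f : G f -> [/\ open (supp f), closed (supp f) & compact (supp f)].
Proof.
by case: KG => -[_ _ _ _ hc] _ /hc[_ os cs]; split=> //; exact: closed_closure.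
Qed.

Lemma KLCC_continuous f : G f -> continuous f.
Proof. by case: KG => -[_ _ _ _ hc] _ /hc[[g []]]. Qed.

Lemma clopen_displaced f (U : set X) x : G f -> open U -> U x -> f x <> x ->
  exists V, [/\ clopen V, V x, V `<=` U & forall a b, V a -> V b -> f a <> b].
Proof.
move=> Gf oU Ux fx.
have cid : continuous (@id X) by move=> y; exact: cvg_id.
have [W [oW Wx Wf]] := sep_nbhs X X f id x hausdorffX (KLCC_continuous _ Gf) cid fx.
have [V [cV Vx VUW]] := boolean_clopen_nbhs _ (U `&` W) x booleanX (openI oU oW) (conj Ux Wx).
exists V; split=> // [y /VUW[]//|a b /VUW[_ Wa] /VUW[_ Wb]]; exact: Wf.
Qed.

(** The swap comes from clause (2) of recognizability. Its moved set is recorded exactly because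
    supports are computed from it. *)
Lemma KLCC_swap f (V : set X) : G f -> clopen V ->
    (forall a b, V a -> V b -> f a <> b) ->
  exists t, [/\ G t, t \o t = id, {in V, t =1 f} & moved t = V `|` f @` V].
Proof.
move=> Gf cV Vf; have [f' [Gf' fK f'K]] := KLCC_inv _ Gf.
have fVV0 : f @` V `&` V = set0.
  by apply/seteqP; split=> // y [[a Va <-] /(Vf _ _ Va)].
have [_ [_ rec]] : recognizable G V by case: KG => _ [_ _ _ + _]; exact.
have := rec _ _ Gf fK f'K fVV0; set t := (t in G t) => Gt.
have tV x : V x -> t x = f x by move=> Vx; rewrite /t mem_set.
have tfV x : V x -> t (f x) = x.
  move=> Vx; rewrite /t memNset; last by move=> /(Vf _ _ Vx).
  by rewrite mem_set ?fK//; exists x.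
have tN x : ~ V x -> ~ (f @` V) x -> t x = x by move=> Vx fVx; rewrite /t !memNset.
exists t; split=> //.
- apply/funext => x /=; have [Vx|nVx] := pselect (V x); first by rewrite (tV x)// tfV.
  have [[y Vy <-]|nfVx] := pselect ((f @` V) x); first by rewrite tfV// tV.
  by rewrite !tN.
- by move=> x /set_mem; exact: tV.
- apply/seteqP; split=> [x|x [Vx|[y Vy <-]]] /=.
  + by apply: contra_notP => /not_orP[? ?]; exact: tN.
  + by rewrite /moved /= tV//; exact: Vf.
  + by rewrite /moved /= tfV// => /esym; exact: Vf.
Qed.

(** Local moving gives [f]; [V] and its image consist of points moved by [f], so the swap stays
    inside [supp f]. *)
Lemma small_swap (A : set X) : open A -> A !=set0 ->
  exists f V t, [/\ [/\ G f, clopen V, V !=set0 & forall a b, V a -> V b -> f a <> b],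
    [/\ G t, t \o t = id, {in V, t =1 f} & moved t = V `|` f @` V] & supp t `<=` A].
Proof.
move=> oA A0; have [f [Gf f1 fA]] : exists g, [/\ G g, g <> id & supp g `<=` A].
  by case: KG => _ [_ lm _ _ _]; exact: lm.
have [x fx] : exists x, f x <> x.
  by apply: contra_notP f1 => /forallNP f1; apply/funext => x; apply: contrapT.
have osf : open (supp f) by case: (KLCC_supp _ Gf).
have [V [cV Vx Vs Vf]] := clopen_displaced _ _ _ Gf osf (moved_sub_supp _ _ _ fx) fx.
have Vm : V `<=` moved f by move=> y Vy; exact: Vf.
have [t [Gt tt tV tm]] := KLCC_swap _ _ Gf cV Vf.
exists f, V, t; split=> //; first by split=> //; exists x.
apply: subset_trans fA; apply: closureS; rewrite -/(moved _) tm.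
move=> y [/Vm//|[z /Vm mz <-]]; move=> /(KLCC_inj _ Gf); exact: mz.
Qed.

Lemma small_involution (A : set X) : open A -> A !=set0 ->
  exists t, [/\ G t, t \o t = id, moved t !=set0 & supp t `<=` A].
Proof.
move=> oA A0; have [f [V [t [[_ _ [x Vx] _] [Gt tt _ tm] tA]]]] := small_swap _ oA A0.
by exists t; split=> //; exists x; rewrite tm; left.
Qed.

(* [s = t \o r] with [t] swapping [V] with [f V] and [r] moving only points of
   [V]: the square of [s] acts on [V] as [r]. *)
Lemma small_order_gt2 (A : set X) : open A -> A !=set0 ->
  exists s y, [/\ G s, moved s `<=` A & s (s y) <> y].
Proof.
move=> oA A0.
have [f [V [t [[Gf [oV _] V0 Vf] [Gt tt tV tm] tA]]]] := small_swap _ oA A0.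
have [r [Gr _ [y ry] rV']] := small_involution _ oV V0.
have rV : moved r `<=` V := subset_trans (moved_sub_supp _ _) rV'.
have mtA : moved t `<=` A := subset_trans (moved_sub_supp _ _) tA.
have Vry : V (r y) by apply: rV => /(KLCC_inj _ Gr).
exists (t \o r), y; split=> /=; first exact: KLCC_comp.
  move=> x; have [Vx _|nVx] := pselect (V x).
    by apply: mtA; rewrite tm; left.
  by rewrite /moved /= (movedN _ _ _ _ rV nVx); exact: mtA.
have -> : r (t (r y)) = t (r y).
  by apply: (movedN _ _ _ _ rV) => H; apply: (Vf _ _ Vry H); rewrite tV// mem_set.
by rewrite -[t (t _)]/((t \o t) _) tt.
Qed.

(** * Inclusion of supports in terms of group operations *)

(* The following three predicates only use the group operations of [G]. *)
Definition local_involution (p u : X -> X) : Prop :=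
  [/\ G u, u \o p = p \o u, u \o u = id
    & forall c c', G c -> G c' -> c \o c' = id -> c \o p = p \o c ->
        u \o (c \o u \o c') = (c \o u \o c') \o u].

Definition local_commutant (p v : X -> X) : Prop :=
  G v /\ forall u, local_involution p u -> v \o u = u \o v.

Definition sub_supp (p w : X -> X) : Prop :=
  forall v, local_commutant p v -> w \o (v \o v) = (v \o v) \o w.

(* If [u x <> x] off [supp p], take [s] supported near [x] with [s \o s <> id];
   then [u] and its [s]-conjugate do not commute. *)
Lemma moved_local_involution p u : G p -> local_involution p u ->
  moved u `<=` supp p.
Proof.
move=> Gp [Gu _ uu ucomm] x ux; apply: contrapT => px.
have [_ csp _] := KLCC_supp _ Gp.
have [V [[oV _] Vx VA Vu]] := clopen_displaced _ _ _ Gu (closed_openC csp) px ux.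
have [s [y [Gs sV ssy]]] := small_order_gt2 _ oV (ex_intro _ x Vx).
have [s' [Gs' sK s'K]] := KLCC_inv _ Gs.
have sp : s \o p = p \o s.
  apply: (moved_disjoint_comm _ _ _ V (KLCC_inj _ Gs) (KLCC_inj _ Gp) sV).
  by move=> z pz /VA; apply; exact: moved_sub_supp.
have sf z : ~ V z -> s z = z by exact: movedN.
have sy : s y <> y by move=> sy; apply: ssy; rewrite sy.
have Vy : V y by exact: sV.
have Vsy : V (s y) by apply: sV => /(KLCC_inj _ Gs).
have uN z : V z -> ~ V (u z) by move=> Vz /(Vu _ _ Vz).
have ss' : s \o s' = id by apply/funext.
(* At [s y] the two sides are [y] and [s (s y)]: [u] carries [V] off [V], where [s] and [s'] are the
   identity. *)
have /(congr1 (@^~ (s y))) /= := ucomm s s' Gs Gs' ss' sp.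
have uuE z : u (u z) = z by rewrite -[u _]/((u \o u) z) uu.
rewrite sK (sf (u y)); last exact: uN.
rewrite uuE.
have -> : s' (u (s y)) = u (s y) by apply: (can_inj sK); rewrite s'K (sf (u _))//; exact: uN.
by rewrite uuE => /esym.
Qed.

(** Clause (1) of recognizability puts the restriction in [G]. Its conjugate by [c] is again [p] on
    a [p]-invariant set and the identity elsewhere, so the two commute. *)
Lemma local_involution_restr p (A : set X) : G p -> p \o p = id -> clopen A ->
  (forall x, A x -> A (p x)) ->
  local_involution p (fun x => if x \in A then p x else x).
Proof.
move=> Gp pp cA pA; set r := (r in local_involution p r).
have ppE z : p (p z) = z by rewrite -[p _]/((p \o p) z) pp.
have pAE z : A (p z) -> A z by move=> /pA; rewrite ppE.
have rA x : A x -> r x = p x by move=> Ax; rewrite /r mem_set.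
have rN x : ~ A x -> r x = x by move=> Ax; rewrite /r memNset.
have rp x : r (p x) = p (r x).
  have [Ax|Ax] := pselect (A x); first by rewrite !rA//; exact: pA.
  by rewrite !rN// => /pAE.
have rr x : r (r x) = x.
  have [Ax|Ax] := pselect (A x); last by rewrite !rN.
  by rewrite (rA x)// rp rA.
split; [|exact/funext|exact/funext|].
- have [_ [rec _]] : recognizable G A by case: KG => _ [_ _ _ + _]; exact.
  apply: rec => //; apply/seteqP; split=> [x [y Ay <-]|x Ax]; first exact: pA.
  by exists (p x); [exact: pA|exact: ppE].
- move=> c c' Gc Gc' cc' cp.
  have cK z : c (c' z) = z by rewrite -[c _]/((c \o c') z) cc'.
  have cpE z : c (p z) = p (c z) by rewrite -[c _]/((c \o p) z) cp.
  have c'pE z : c' (p z) = p (c' z) by apply: (KLCC_inj _ Gc); rewrite cpE !cK.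
  apply/funext => x /=.
  have crpE z : c (r (c' (p z))) = p (c (r (c' z))) by rewrite c'pE rp cpE.
  have [Ax|Ax] := pselect (A x).
    rewrite (rA x)// crpE.
    have [Ac|Ac] := pselect (A (c' x)).
      by rewrite (rA (c' x))// cpE cK ppE rA ?ppE//; exact: pA.
    by rewrite (rN (c' x))// cK rA.
  rewrite (rN x)//; have [Ac|Ac] := pselect (A (c' x)).
    by rewrite (rA (c' x))// cpE cK rN // => /pAE.
  by rewrite (rN (c' x))// cK rN.
Qed.

(* [v] commutes with [p] restricted to every clopen [p]-invariant set, so it
   preserves each orbit [{x, p x}] with two elements. *)
Lemma moved_local_commutant2 p v : G p -> p \o p = id -> local_commutant p v ->
  moved (v \o v) `<=` ~` supp p.
Proof.
move=> Gp pp [Gv vcomm].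
have ppE z : p (p z) = z by rewrite -[p _]/((p \o p) z) pp.
have vp z : v (p z) = p (v z).
  have := vcomm _ (local_involution_restr _ _ Gp pp clopenT (fun _ _ => I)).
  by move=> /(congr1 (@^~ z)) /=; rewrite !in_setT.
have fix2 x : p x <> x -> v (v x) = x.
  move=> px; have [vx|vx] := pselect (v x = x); first by rewrite !vx.
  have [vpx|vpx] := pselect (v x = p x); first by rewrite vpx vp vpx ppE.
  (* A clopen [p]-invariant set [A] is built around [x] so as to avoid [v x]; commuting with [p]
     restricted to [A] forces [v (p x) = v x]. *)
  exfalso; pose U := ~` [set v x; p (v x)].
  have oU : open U.
    rewrite /U setCU; apply: openI; apply: closed_openC;
      apply: accessible_closed_set1; exact: hausdorff_accessible.
  have Ux : U x.
    by rewrite /U /setC /= => -[/esym//|xpv]; apply: vpx; rewrite [in RHS]xpv ppE.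
  have [B [cB Bx BU]] := boolean_clopen_nbhs _ _ _ booleanX oU Ux.
  pose A := B `|` p @^-1` B.
  have cA : clopen A.
    by apply: clopenU => //; apply: preimage_clopen => //; exact: KLCC_continuous.
  have pA z : A z -> A (p z).
    by move=> [Bz|Bz]; [right; rewrite /= ppE|left].
  have Ax : A x by left.
  have nAvx : ~ A (v x).
    by move=> [/BU|/BU]; apply; [left|right].
  have := vcomm _ (local_involution_restr _ _ Gp pp cA pA).
  move=> /(congr1 (@^~ x)) /=; rewrite mem_set// memNset// => /(KLCC_inj _ Gv).
  exact: px.
move=> x vvx sx.
have Gvv : G (v \o v) by exact: KLCC_comp.
(* [fix2] speaks only of points moved by [p]; as [x] is in their closure, one of them would be
   displaced by [v \o v]. *)
have [V [[oV _] Vx _ Vv]] :=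
  clopen_displaced _ _ _ Gvv openT I vvx.
have [y [/= py Vy]] := sx V (open_nbhs_nbhs (conj oV Vx)).
exact: (Vv y y Vy Vy (fix2 y py)).
Qed.

(** If [w] moves some [x] off [supp p], an [s] with [s \o s <> id] moving only points near [x] is in
    the commutant, yet its square does not commute with [w]. Conversely, the squares live off
    [supp p]. *)
Lemma sub_suppE p w : G p -> p \o p = id -> G w ->
  sub_supp p w <-> supp w `<=` supp p.
Proof.
move=> Gp pp Gw; split=> [pw|wp v pv]; last first.
  apply: (moved_disjoint_comm _ _ _ (supp p) (KLCC_inj _ Gw)).
  - by case: pv => Gv _; exact: KLCC_inj (KLCC_comp _ _ Gv Gv).
  - exact: subset_trans (moved_sub_supp _ _) wp.
  - exact: moved_local_commutant2.
have [_ csp _] := KLCC_supp _ Gp.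
rewrite (iffLR (closure_id _) csp); apply: closureS => x wx; apply: contrapT => px.
have [V [[oV _] Vx VA Vw]] := clopen_displaced _ _ _ Gw (closed_openC csp) px wx.
have [s [y [Gs sV ssy]]] := small_order_gt2 _ oV (ex_intro _ x Vx).
have ps : local_commutant p s.
  split=> // u pu; have [Gu _ _ _] := pu.
  apply: (moved_disjoint_comm _ _ _ V (KLCC_inj _ Gs) (KLCC_inj _ Gu) sV).
  by move=> z /(moved_local_involution _ _ Gp pu) pz /VA.
have /(congr1 (@^~ y)) /= := pw s ps.
have Vy : V y by apply: sV => sy; apply: ssy; rewrite sy.
have sf z : ~ V z -> s z = z by exact: movedN.
have nVwy : ~ V (w y) by move=> /(Vw _ _ Vy).
by rewrite !(sf (w y))// => /(KLCC_inj _ Gw).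
Qed.

(** * A basis from supports of involutions; supports of conjugates *)

(* For [V] small, [x] has translates [f x] and [g x] with [V], [f V] and [g V]
   disjoint; the swaps of [V] with [f V] and with [g V] have supports meeting
   in [V]. *)
Lemma involution_supp_basis (U : set X) x : open U -> U x ->
  exists p q, [/\ G p, p \o p = id, G q, q \o q = id
    & (supp p `&` supp q) x /\ supp p `&` supp q `<=` U].
Proof.
move=> oU Ux.
have [f [g [Gf Gg fx gx fgx]]] : exists f g, [/\ G f, G g, f x <> x, g x <> x & f x <> g x].
  have [_ [_ _ _ _ /(_ x)[xa [xb [xc [+ [+ []]]]]]]] := KG.
  move=> [a [Ga <-]] [b [Gb <-]] [c [Gc <-]] [ab bc ac].
  have [ax|ax] := pselect (a x = x).
    by rewrite ax in ab ac; exists b, c; split=> // /esym.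
  have [bx|bx] := pselect (b x = x); last by exists a, b.
  by rewrite bx in ab bc; exists a, c; split=> // /esym.
have [W [oW Wx Wfg]] := sep_nbhs X X f g x hausdorffX
  (KLCC_continuous _ Gf) (KLCC_continuous _ Gg) fgx.
have [V1 [[oV1 _] V1x V1U V1f]] := clopen_displaced _ _ _ Gf oU Ux fx.
have [V [cV Vx VW Vg]] := clopen_displaced _ _ _ Gg (openI oV1 oW) (conj V1x Wx) gx.
have Vf a b : V a -> V b -> f a <> b by move=> /VW[Va _] /VW[Vb _]; exact: V1f.
have clopen_image h : G h -> clopen (h @` V).
  move=> Gh; have [h' [Gh' hK h'K]] := KLCC_inv _ Gh.
  rewrite (_ : h @` V = h' @^-1` V); first exact: preimage_clopen (KLCC_continuous _ Gh').
  apply/seteqP; split=> [_ [y Vy <-]|y Vy] /=; first by rewrite hK.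
  by exists (h' y).
have supp_swap h t : G h -> moved t = V `|` h @` V -> supp t = V `|` h @` V.
  move=> Gh tm; rewrite /supp -/(moved t) tm; apply/esym/closure_id.
  by have [] := clopenU cV (clopen_image _ Gh).
have [p [Gp pp _ /(supp_swap _ _ Gf) mp]] := KLCC_swap _ _ Gf cV Vf.
have [q [Gq qq _ /(supp_swap _ _ Gg) mq]] := KLCC_swap _ _ Gg cV Vg.
exists p, q; split=> //; rewrite mp mq; split; first by split; left.
have VU : V `<=` U by move=> y /VW[/V1U].
move=> y [[/VU//|[a Va <-]] [/VU//|[b Vb ab]]].
by exfalso; apply: (Wfg a b) => //; [case: (VW _ Va)|case: (VW _ Vb)].
Qed.

Lemma supp_conj_sub f f' g : G f -> G f' -> cancel f' f ->
  supp (f' \o g \o f) `<=` f @^-1` supp g.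
Proof.
move=> Gf Gf' f'K x sx B nB.
have [y [/= my By]] := sx _ (KLCC_continuous _ Gf x _ nB).
by exists (f y); split=> //= gfy; apply: my; apply: (KLCC_inj _ Gf); rewrite f'K.
Qed.

Lemma supp_conj f f' g : G f -> G f' -> cancel f f' -> cancel f' f ->
  supp (f' \o g \o f) = f @^-1` supp g.
Proof.
move=> Gf Gf' fK f'K; apply/seteqP; split; first exact: supp_conj_sub.
move=> x /=.
have {1}-> : g = f \o (f' \o g \o f) \o f' by apply/funext => y /=; rewrite !f'K.
by move=> /(supp_conj_sub _ _ _ Gf' Gf fK) /=; rewrite fK.
Qed.

End KLCC.

(** * Transport of supports along an isomorphism *)

Section transport.
Variables (X1 X2 : topologicalType) (G1 : set (X1 -> X1)) (G2 : set (X2 -> X2)).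
Variable Phi : (X1 -> X1) -> (X2 -> X2).
Hypotheses (KG1 : in_KLCC G1) (KG2 : in_KLCC G2) (iPhi : group_iso G1 G2 Phi).

Let G1_comp f g : G1 f -> G1 g -> G1 (f \o g). Proof. exact: KLCC_comp. Qed.

Let PhiG f : G1 f -> G2 (Phi f). Proof. by case: iPhi => + _ _ _; exact. Qed.

Let PhiM f g : G1 f -> G1 g -> Phi (f \o g) = Phi f \o Phi g.
Proof. by case: iPhi => _ _ _; exact. Qed.

Let PhiI f g : G1 f -> G1 g -> Phi f = Phi g -> f = g.
Proof. by case: iPhi => _ + _ _; exact. Qed.

Lemma group_iso_id : Phi id = id.
Proof.
have G1id := KLCC_id _ _ KG1; apply/funext => x.
apply: (KLCC_inj _ _ KG2 _ (PhiG _ G1id)).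
by have /(congr1 (@^~ x)) /= := PhiM _ _ G1id G1id.
Qed.

(** [sub_supp] depends positively on the local involutions, so it suffices that [Phi] carries these
    forward; quantifiers over [G2] are pulled back by surjectivity. *)
Lemma group_iso_sub_supp p w : G1 p -> G1 w ->
  sub_supp X1 G1 p w -> sub_supp X2 G2 (Phi p) (Phi w).
Proof.
move=> Gp Gw pw; have [_ _ Phi_surj _] := iPhi.
have comm f g : G1 f -> G1 g -> Phi f \o Phi g = Phi g \o Phi f <-> f \o g = g \o f.
  move=> Gf Gg; split=> [|fg]; last by rewrite -!PhiM// fg.
  by rewrite -!PhiM//; apply: PhiI; exact: G1_comp.
have inv u : local_involution X1 G1 p u -> local_involution X2 G2 (Phi p) (Phi u).
  move=> [Gu up uu ucomm]; split; [exact: PhiG|exact/comm| |].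
    by rewrite -PhiM// uu group_iso_id.
  move=> _ _ /Phi_surj[c Gc <-] /Phi_surj[c' Gc' <-] cc' /comm cp.
  rewrite -(PhiM c u)// -(PhiM (c \o u) c')//; last exact: G1_comp.
  apply/comm => //; first by do 2 (apply: G1_comp => //).
  apply: ucomm => //; last exact: cp.
  apply: PhiI; [exact: G1_comp|exact: KLCC_id|].
  by rewrite (PhiM c c')// group_iso_id.
move=> _ [/Phi_surj[v Gv <-] vcomm]; rewrite -(PhiM v v)//.
apply/comm => //; first exact: G1_comp.
by apply: pw; split=> // u pu; have [Gu _ _ _] := pu; apply/comm/vcomm => //; exact: inv.
Qed.

Lemma group_iso_supp p w : G1 p -> p \o p = id -> G1 w ->
  supp w `<=` supp p -> supp (Phi w) `<=` supp (Phi p).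
Proof.
move=> Gp pp Gw /(sub_suppE _ _ KG1 _ _ Gp pp Gw) /(group_iso_sub_supp _ _ Gp Gw).
move=> /(sub_suppE _ _ KG2); apply; [exact: PhiG| |exact: PhiG].
by rewrite -PhiM// pp group_iso_id.
Qed.

(** Makes the two sides symmetric: each statement about [Phi] can also be applied to [Psi]. *)
Lemma group_iso_inv : exists Psi, [/\ group_iso G2 G1 Psi,
  forall f, G1 f -> Psi (Phi f) = f & forall h, G2 h -> Phi (Psi h) = h].
Proof.
have [_ _ Phi_surj _] := iPhi.
have /choice[Psi PsiP] h : exists f, G2 h -> G1 f /\ Phi f = h.
  have [/Phi_surj[f Gf <-]|nGh] := pselect (G2 h); first by exists f.
  by exists id => /nGh.
have PsiG h : G2 h -> G1 (Psi h) by move=> /PsiP[].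
have PhiK h : G2 h -> Phi (Psi h) = h by move=> /PsiP[].
have PsiK f : G1 f -> Psi (Phi f) = f.
  by move=> Gf; have Gpf := PhiG _ Gf; apply: PhiI; rewrite ?PhiK//; exact: PsiG.
exists Psi; split=> //; split=> //.
- by move=> f g Gf Gg fg; rewrite -(PhiK f)// fg PhiK.
- by move=> f Gf; exists (Phi f); [exact: PhiG|exact: PsiK].
- move=> f g Gf Gg; have Gfg := KLCC_comp _ _ KG2 _ _ Gf Gg.
  have [Pf Pg] := (PsiG _ Gf, PsiG _ Gg).
  by apply: PhiI; [exact: PsiG|exact: G1_comp|rewrite (PhiM _ _ Pf Pg) !PhiK].
Qed.

End transport.

(** * Matching of points *)

(** A relation rather than a function, so that both directions are treated alike; the tests [p] are
    involutions because inclusion of supports is characterized for these. *)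
Definition matched (X1 X2 : topologicalType) (G1 : set (X1 -> X1))
    (Phi : (X1 -> X1) -> (X2 -> X2)) (x : X1) (y : X2) : Prop :=
  forall p, G1 p -> p \o p = id -> supp p x <-> supp (Phi p) y.

Section points.
Variables (X1 X2 : topologicalType) (G1 : set (X1 -> X1)) (G2 : set (X2 -> X2)).
Variables (Phi : (X1 -> X1) -> (X2 -> X2)) (Psi : (X2 -> X2) -> (X1 -> X1)).
Hypotheses (KG1 : in_KLCC G1) (KG2 : in_KLCC G2).
Hypotheses (iPhi : group_iso G1 G2 Phi) (iPsi : group_iso G2 G1 Psi).
Hypotheses (PhiK : forall f, G1 f -> Psi (Phi f) = f).
Hypotheses (PsiK : forall h, G2 h -> Phi (Psi h) = h).

Let PhiG f : G1 f -> G2 (Phi f). Proof. by case: iPhi => + _ _ _; exact. Qed.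

Let PsiG f : G2 f -> G1 (Psi f). Proof. by case: iPsi => + _ _ _; exact. Qed.

Let PhiM f g : G1 f -> G1 g -> Phi (f \o g) = Phi f \o Phi g.
Proof. by case: iPhi => _ _ _; exact. Qed.

Let PsiM f g : G2 f -> G2 g -> Psi (f \o g) = Psi f \o Psi g.
Proof. by case: iPsi => _ _ _; exact. Qed.

Let Phi_id : Phi id = id. Proof. exact: group_iso_id iPhi. Qed.

Let Psi_id : Psi id = id. Proof. exact: group_iso_id iPsi. Qed.

Let Phi2 p : G1 p -> p \o p = id -> Phi p \o Phi p = id.
Proof. by move=> Gp pp; rewrite -PhiM// pp. Qed.

Let Psi2 p : G2 p -> p \o p = id -> Psi p \o Psi p = id.
Proof. by move=> Gp pp; rewrite -PsiM// pp. Qed.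

(** Were the images to meet, a nontrivial involution [s] supported in the open intersection would
    have [Psi s] supported in the empty set. *)
Lemma group_iso_supp_disjoint t p : G1 t -> t \o t = id -> G1 p -> p \o p = id ->
  supp t `&` supp p = set0 -> supp (Phi t) `&` supp (Phi p) = set0.
Proof.
move=> Gt tt Gp pp tp; apply/eqP; apply: contrapT => /negP/set0P tp2.
have [ot _ _] := KLCC_supp _ _ KG2 _ (PhiG _ Gt).
have [op _ _] := KLCC_supp _ _ KG2 _ (PhiG _ Gp).
have [s [Gs ss [y sy] stp]] := small_involution _ _ KG2 _ (openI ot op) tp2.
have sub q : G1 q -> q \o q = id -> supp s `<=` supp (Phi q) ->
    supp (Psi s) `<=` supp q.
  move=> Gq qq sq; rewrite -[q]PhiK//.
  exact: (group_iso_supp _ _ _ _ _ KG2 KG1 iPsi _ _ (PhiG _ Gq) (Phi2 _ Gq qq)).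
have Ps0 x : Psi s x = x.
  apply: contrapT => /(moved_sub_supp _ (Psi s)) Psx.
  have : (supp t `&` supp p) x.
    by split; apply: sub Psx => // z /stp[].
  by rewrite tp.
apply: sy; rewrite -(PsiK _ Gs) (_ : Psi s = id) ?Phi_id//.
by apply/funext.
Qed.

(* [y] is a cluster point of the filter of the sets containing the supports of
   all [Phi t], [t] an involution supported close to [x]. *)
Lemma matched_exists x : exists y, matched X1 X2 G1 Phi x y.
Proof.
pose F : set_system X2 := [set B | exists N, [/\ open N, N x
  & forall t, G1 t -> t \o t = id -> supp t `<=` N -> supp (Phi t) `<=` B]].
have FF : ProperFilter F.
  split.
    (* Properness: otherwise a nontrivial involution supported in [N] would have trivial image. *)
    move=> [N [oN Nx Nt]].
    have [t [Gt tt [z tz] tN]] := small_involution _ _ KG1 _ oN (ex_intro _ x Nx).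
    apply: tz; rewrite -(PhiK _ Gt) (_ : Phi t = id) ?Psi_id//.
    apply/funext => y; apply: contrapT => /(moved_sub_supp _ (Phi t)).
    exact: Nt.
  split.
  - by exists setT; split=> //; exact: openT.
  - move=> P Q [N [oN Nx NP]] [N' [oN' N'x NQ]]; exists (N `&` N').
    split=> // [|t Gt tt tN]; first exact: openI.
    by rewrite subsetI; split; [apply: NP|apply: NQ] => // z /tN[].
  - move=> P Q PQ [N [oN Nx NP]]; exists N; split=> // t Gt tt tN.
    exact: subset_trans (NP t Gt tt tN) PQ.
have Fin p : G1 p -> p \o p = id -> supp p x -> F (supp (Phi p)).
  move=> Gp pp px; exists (supp p); split=> //; first by case: (KLCC_supp _ _ KG1 _ Gp).
  by move=> t Gt _; exact: (group_iso_supp _ _ _ _ _ KG1 KG2 iPhi _ _ Gp pp).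
have Fout p : G1 p -> p \o p = id -> ~ supp p x -> F (~` supp (Phi p)).
  move=> Gp pp px; exists (~` supp p); split=> //.
    by apply: closed_openC; case: (KLCC_supp _ _ KG1 _ Gp).
  move=> t Gt tt /disjoints_subset tp; apply/disjoints_subset.
  exact: group_iso_supp_disjoint.
(* [X2] need not be compact: the cluster point is found in the compact support of one [Phi p] with
   [x] in [supp p]. *)
have [p [_ [Gp pp _ _ [[px _] _]]]] := involution_supp_basis _ _ KG1 _ x openT I.
have [_ _ cp] := KLCC_supp _ _ KG2 _ (PhiG _ Gp).
have [y [_ Fy]] := cp F FF (Fin _ Gp pp px).
exists y; move=> q Gq qq; have [oq clq _] := KLCC_supp _ _ KG2 _ (PhiG _ Gq).
have clF B : closed B -> F B -> B y.
  by move=> cB FB; rewrite (iffLR (closure_id _) cB) => V nV; exact: Fy.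
split=> [qx|]; first by apply: clF => //; exact: Fin.
apply: contraPP => qx.
by apply: (clF (~` supp (Phi q))); [exact: open_closedC|exact: Fout].
Qed.

Lemma matched_sym x y : matched X1 X2 G1 Phi x y -> matched X2 X1 G2 Psi y x.
Proof.
move=> xy p Gp pp; rewrite -[in X in X <-> _](PsiK _ Gp); apply: iff_sym.
by apply: xy; [exact: PsiG|exact: Psi2].
Qed.

(** A basis set around [y] inside [U] is pulled back through [Psi]. Since all matched pairs over [N]
    are covered, this serves both uniqueness and continuity. *)
Lemma matched_nbhs x y (U : set X2) : matched X1 X2 G1 Phi x y -> open U -> U y ->
  exists2 N, open N /\ N x
    & forall x' y', N x' -> matched X1 X2 G1 Phi x' y' -> U y'.
Proof.
move=> xy oU Uy.
have [p [q [Gp pp Gq qq [[py qy] pqU]]]] := involution_supp_basis _ _ KG2 _ y oU Uy.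
exists (supp (Psi p) `&` supp (Psi q)).
  split; last by split; apply/(matched_sym _ _ xy).
  have oPsi r : G2 r -> open (supp (Psi r)) by move=> /PsiG/(KLCC_supp _ _ KG1)[].
  by apply: openI; exact: oPsi.
by move=> x' y' [px qx] /matched_sym xy'; apply: pqU; split; apply/xy'.
Qed.

Lemma matched_fun x y y' : matched X1 X2 G1 Phi x y -> matched X1 X2 G1 Phi x y' ->
  y = y'.
Proof.
move=> xy xy'; apply: contrapT => yy'.
have oU : open (~` [set y']).
  apply: closed_openC; apply: accessible_closed_set1.
  by apply: hausdorff_accessible; case: KG2 => -[[]].
have [N [_ Nx] NU] := matched_nbhs _ _ _ xy oU yy'.
exact: NU _ _ Nx xy' erefl.
Qed.

(** Testing [g x] with [p] amounts to testing [x] with the conjugate [g' \o p \o g]. *)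
Lemma matched_equivariant g x y : G1 g -> matched X1 X2 G1 Phi x y ->
  matched X1 X2 G1 Phi (g x) (Phi g y).
Proof.
move=> Gg xy p Gp pp; have [g' [Gg' gK g'K]] := KLCC_inv _ _ KG1 _ Gg.
have gg' : g \o g' = id by exact/funext.
have g'g : g' \o g = id by exact/funext.
have Gpg : G1 (g' \o p) by exact: KLCC_comp.
have := xy (g' \o p \o g) (KLCC_comp _ _ KG1 _ _ Gpg Gg).
rewrite (PhiM _ _ Gpg Gg) (PhiM _ _ Gg' Gp) (supp_conj _ _ KG1 _ _ _ Gg Gg' gK g'K).
have PK : cancel (Phi g) (Phi g').
  by move=> z; rewrite -[LHS]/((Phi g' \o Phi g) z) -PhiM// g'g Phi_id.
have PK' : cancel (Phi g') (Phi g).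
  by move=> z; rewrite -[LHS]/((Phi g \o Phi g') z) -PhiM// gg' Phi_id.
rewrite (supp_conj _ _ KG2 _ _ _ (PhiG _ Gg) (PhiG _ Gg') PK PK'); apply.
apply/funext => z /=; rewrite g'K.
by rewrite -[p (p _)]/((p \o p) _) pp /= gK.
Qed.

Lemma matched_continuous phi : (forall x, matched X1 X2 G1 Phi x (phi x)) ->
  continuous phi.
Proof.
move=> phiP x U; rewrite nbhsE => -[V [oV Vx] VU].
have [N [oN Nx] NV] := matched_nbhs _ _ _ (phiP x) oV Vx.
apply: filterS (open_nbhs_nbhs (conj oN Nx)) => x' Nx'.
exact: VU (NV _ _ Nx' (phiP x')).
Qed.

End points.

(** * Construction of the conjugating homeomorphism *)

Theorem theorem6p19 (X1 X2 : topologicalType)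
  (G1 : set (X1 -> X1)) (G2 : set (X2 -> X2))
  (Phi : (X1 -> X1) -> (X2 -> X2)) :
  @in_KLCC X1 G1 -> @in_KLCC X2 G2 -> group_iso G1 G2 Phi ->
  exists (phi : X1 -> X2) (psi : X2 -> X1),
    [/\ cancel phi psi, cancel psi phi, continuous phi, continuous psi
      & forall g, G1 g -> Phi g = phi \o g \o psi].
Proof.
move=> K1 K2 iPhi.
have [Psi [iPsi PhiK PsiK]] := group_iso_inv _ _ _ _ _ K1 K2 iPhi.
have /choice[phi phiP] := matched_exists _ _ _ _ _ _ K1 K2 iPhi iPsi PhiK PsiK.
have /choice[psi psiP] := matched_exists _ _ _ _ _ _ K2 K1 iPsi iPhi PsiK PhiK.
have psiP' y : matched X1 X2 G1 Phi (psi y) y.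
  exact: (matched_sym _ _ _ _ _ _ K2 K1 iPhi PhiK).
have phiP' x : matched X2 X1 G2 Psi (phi x) x.
  exact: (matched_sym _ _ _ _ _ _ K1 K2 iPsi PsiK).
have fun12 := matched_fun _ _ _ _ _ _ K1 K2 iPsi PsiK.
have fun21 := matched_fun _ _ _ _ _ _ K2 K1 iPhi PhiK.
exists phi, psi; split.
- by move=> x; exact: fun21 (psiP _) (phiP' x).
- by move=> y; exact: fun12 (phiP _) (psiP' y).
- exact: (matched_continuous _ _ _ _ _ _ K1 K2 iPsi PsiK).
- exact: (matched_continuous _ _ _ _ _ _ K2 K1 iPhi PhiK).
(* [psi y] is matched with [y], so [g (psi y)] is matched with [Phi g y] as well as with its value
   under [phi]. *)
- move=> g Gg; apply/funext => y /=; apply: fun12 (phiP _).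
  exact: (matched_equivariant _ _ _ _ _ K1 K2 iPhi).
Qed.
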